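(* Let $F:\mathbb R^m\to\mathbb R^m$ and let $X^*\in\mathbb R^m$ satisfy $F(X^* )=X^*$. Assume that there exist $R>0$, diagonal $m\times m$ matrices $U_n=\mathrm{diag}(d_{1,n},\dots,d_{m,n})$, $n\in\mathbb N$, with entries $d_{i,n}\in[0,1)$, and a number $\nu^*=\nu^*(R)\in(0,1)$ such that $$\|(I-U_n)[F(X)-X^*]\|\le \nu^*\,\|X-X^*\|\quad\text{for all } n\in\mathbb N \text{ and all } X\in B_R(X^* ).$$ Then any solution $(X_n)$ of $$X_{n+1}=U_{n+1}X^*+(I-U_{n+1})F(X_n),\quad n\in\mathbb N_0,$$ with $X_0\in B_R(X^* )$ converges to $X^*$, and $X^*$ is asymptotically stable in $B_R(X^* )$ for this system.
   Context: $\mathbb N_0=\{0\}\cup\mathbb N$; $\|\cdot\|$ is a fixed norm on $\mathbb R^m$; $I$ is the $m\times m$ identity matrix; $B_R(X^* )=\{X\in\mathbb R^m:\|X-X^*\|<R\}$. ''Asymptotically stable in $B_R(X^* )$'' means that $X^*$ is a (Lyapunov) stable equilibrium of the system and every solution with $X_0\in B_R(X^* )$ converges to $X^*$. *)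

(* Defs.v *)
From HB Require Import structures.
From mathcomp Require Import all_boot all_order all_algebra.
From mathcomp Require Import all_classical all_reals all_analysis.
Set Implicit Arguments.
Unset Strict Implicit.
Unset Printing Implicit Defensive.
Import Order.TTheory GRing.Theory Num.Theory.
Import numFieldNormedType.Exports.
Local Open Scope classical_set_scope.
Local Open Scope ring_scope.

(* The canonical norm of ['cV[R]_m] in the library is the max norm.  An
   arbitrary norm is therefore a function [N] satisfying the norm axioms, and
   balls, convergence and stability below are all taken with respect to [N].
   Nonnegativity of [N] follows from the three axioms. *)
Record is_norm (R : realType) (V : lmodType R) (N : V -> R) : Prop := IsNorm {
  is_norm_triangle : forall x y, N (x + y) <= N x + N y ;
  is_norm_homog : forall (a : R) x, N (a *: x) = `|a| * N x ;
  is_norm_definite : forall x, N x = 0 -> x = 0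
}.

Definition norm_ball (R : realType) (V : lmodType R) (N : V -> R)
    (x : V) (r : R) : set V :=
  [set y | N (y - x) < r].

Definition norm_cvg (R : realType) (V : lmodType R) (N : V -> R)
    (X : nat -> V) (x : V) : Prop :=
  N (X n - x) @[n --> \oo] --> (0 : R).

(* A nonautonomous first-order difference equation X_{n+1} = f_n(X_n). *)

Definition solution_from (V : Type) (f : nat -> V -> V) (n0 : nat)
    (X : nat -> V) : Prop :=
  forall n, (n0 <= n)%N -> X n.+1 = f n (X n).

Definition solution (V : Type) (f : nat -> V -> V) (X : nat -> V) : Prop :=
  solution_from f 0 X.

Definition equilibrium (V : Type) (f : nat -> V -> V) (x : V) : Prop :=
  forall n, f n x = x.

(* Lyapunov stability of a nonautonomous equation is required for every initial
   time [n0]; [delta] may depend on [n0].  The terms of [X] before [n0] are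
   irrelevant. *)
Definition lyapunov_stable (R : realType) (V : lmodType R) (N : V -> R)
    (f : nat -> V -> V) (x : V) : Prop :=
  forall (n0 : nat) (eps : R), 0 < eps ->
  exists2 delta : R, 0 < delta &
    forall X : nat -> V, solution_from f n0 X -> norm_ball N x delta (X n0) ->
    forall n, (n0 <= n)%N -> norm_ball N x eps (X n).

Definition asymptotically_stable_in (R : realType) (V : lmodType R)
    (N : V -> R) (f : nat -> V -> V) (x : V) (B : set V) : Prop :=
  [/\ equilibrium f x,
      lyapunov_stable N f x &
      forall X : nat -> V, solution f X -> B (X 0%N) -> norm_cvg N X x].

Definition controlled_map (R : realType) (m : nat)
    (F : 'cV[R]_m -> 'cV[R]_m) (U : nat -> 'M[R]_m) (Xstar : 'cV[R]_m)
    (n : nat) (X : 'cV[R]_m) : 'cV[R]_m :=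
  U n.+1 *m Xstar + (1%:M - U n.+1) *m F X.

(* Main.v *)
Require Import Defs.
From HB Require Import structures.
From mathcomp Require Import all_boot all_order all_algebra.
From mathcomp Require Import all_classical all_reals all_analysis.
Set Implicit Arguments.
Unset Strict Implicit.
Unset Printing Implicit Defensive.
Import Order.TTheory GRing.Theory Num.Theory.
Import numFieldNormedType.Exports.
Local Open Scope classical_set_scope.
Local Open Scope ring_scope.

(** Subtracting the fixed point turns the controlled equation into
[X_{n+1} - Xstar = (I - U_{n+1}) (F X_n - Xstar)], so the hypothesis says that
each step of the nonautonomous equation multiplies the [N]-distance to [Xstar]
by at most [nu < 1], as long as the state lies in the ball of radius [r].  Such
a step does not increase the distance, so it stays in the ball, and induction gives
the geometric estimate [N (X_{n0+k} - Xstar) <= nu ^ k * N (X_{n0} - Xstar)]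
from any initial time [n0] ([local_contraction_geometric]).  With [n0 = 0] this
is convergence; since [nu ^ k <= 1], it is also Lyapunov stability, with
[delta = min eps r] independent of the initial time.  This part
concerns any family of maps of a normed space that contract towards a point,
and [controlled_map_subl] brings the theorem to that case. *)

Lemma is_norm_ge0 (R : realType) (V : lmodType R) (N : V -> R) (x : V) :
  is_norm N -> 0 <= N x.
Proof.
move=> [ND NZ _].
have N0 : N 0 = 0 by rewrite -(scale0r (0 : V)) NZ normr0 mul0r.
have NN : N (- x) = N x by rewrite -scaleN1r NZ normrN1 mul1r.
by have := ND x (- x); rewrite subrr N0 NN -mulr2n pmulrn_lge0.
Qed.

Definition local_contraction (R : realType) (V : lmodType R) (N : V -> R)
    (f : nat -> V -> V) (x : V) (r nu : R) : Prop :=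
  forall n y, norm_ball N x r y -> N (f n y - x) <= nu * N (y - x).

(** The estimate is proved for the distance alone; that the orbit stays in the
ball, which the next contraction step needs, follows from it at each stage
because [nu ^+ k <= 1]. *)
Lemma local_contraction_geometric (R : realType) (V : lmodType R) (N : V -> R)
    (f : nat -> V -> V) (x : V) (r nu : R) (n0 : nat) (X : nat -> V) :
  is_norm N -> 0 <= nu <= 1 -> local_contraction N f x r nu ->
  solution_from f n0 X -> norm_ball N x r (X n0) ->
  forall k, N (X (n0 + k)%N - x) <= nu ^+ k * N (X n0 - x).
Proof.
move=> N_norm /andP[nu_ge0 nu_le1] fC Xsol X0; elim=> [|k IHk].
  by rewrite addn0 expr0 mul1r.
have Xk : norm_ball N x r (X (n0 + k)%N).
  apply: le_lt_trans X0; apply: le_trans IHk _.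
  by rewrite ler_piMl ?is_norm_ge0 ?exprn_ile1.
rewrite addnS Xsol ?leq_addr// exprS -mulrA.
by apply: le_trans (fC _ _ Xk) _; rewrite ler_wpM2l.
Qed.

Lemma local_contraction_cvg (R : realType) (V : lmodType R) (N : V -> R)
    (f : nat -> V -> V) (x : V) (r nu : R) (X : nat -> V) :
  is_norm N -> 0 <= nu < 1 -> local_contraction N f x r nu ->
  solution f X -> norm_ball N x r (X 0%N) -> norm_cvg N X x.
Proof.
move=> N_norm /andP[nu_ge0 nu_lt1] fC Xsol X0.
have geom : nu ^+ n * N (X 0%N - x) @[n --> \oo] --> (0 : R).
  rewrite -(mul0r (N (X 0%N - x))); apply: cvgMr_tmp.
  by apply: cvg_expr; rewrite ger0_norm.
apply: (squeeze_cvgr _ (cvg_cst 0) geom).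
apply: nearW => n; rewrite is_norm_ge0//=.
apply: (local_contraction_geometric (n0 := 0%N) N_norm _ fC Xsol X0).
by rewrite nu_ge0 ltW.
Qed.

Lemma local_contraction_stable (R : realType) (V : lmodType R) (N : V -> R)
    (f : nat -> V -> V) (x : V) (r nu : R) :
  is_norm N -> 0 < r -> 0 <= nu <= 1 -> local_contraction N f x r nu ->
  lyapunov_stable N f x.
Proof.
move=> N_norm r_gt0 nu01 fC n0 eps eps_gt0.
exists (Num.min eps r) => [|X Xsol]; first by rewrite lt_min eps_gt0.
rewrite /norm_ball/= lt_min => /andP[Xeps Xr] n /subnKC <-.
apply: le_lt_trans Xeps.
apply: le_trans (local_contraction_geometric N_norm nu01 fC Xsol Xr _) _.
by case/andP: nu01 => *; rewrite ler_piMl ?is_norm_ge0 ?exprn_ile1.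
Qed.

Lemma controlled_map_subl (R : realType) (m : nat) (F : 'cV[R]_m -> 'cV[R]_m)
    (U : nat -> 'M[R]_m) (x X : 'cV[R]_m) (n : nat) :
  controlled_map F U x n X - x = (1%:M - U n.+1) *m (F X - x).
Proof.
rewrite /controlled_map mulmxBr [(_ - _) *m x]mulmxBl mul1mx opprB.
by rewrite addrAC [RHS]addrC.
Qed.

Theorem theorem2p1 (R : realType) (m : nat) (N : 'cV[R]_m -> R)
  (N_norm : is_norm N)
  (F : 'cV[R]_m -> 'cV[R]_m) (Xstar : 'cV[R]_m) (F_fix : F Xstar = Xstar)
  (r : R) (r_gt0 : 0 < r)
  (d : nat -> 'rV[R]_m) (U : nat -> 'M[R]_m)
  (U_diag : forall n : nat, (0 < n)%N -> U n = diag_mx (d n))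
  (d_bounds : forall (n : nat) (i : 'I_m), (0 < n)%N -> 0 <= d n 0 i < 1)
  (nu : R) (nu_bounds : 0 < nu < 1)
  (contraction : forall (n : nat) (X : 'cV[R]_m), (0 < n)%N ->
     norm_ball N Xstar r X ->
     N ((1%:M - U n) *m (F X - Xstar)) <= nu * N (X - Xstar)) :
  (forall X : nat -> 'cV[R]_m,
     solution (controlled_map F U Xstar) X ->
     norm_ball N Xstar r (X 0%N) -> norm_cvg N X Xstar)
  /\ asymptotically_stable_in N (controlled_map F U Xstar) Xstar
       (norm_ball N Xstar r).
Proof.
have [nu_gt0 nu_lt1] := andP nu_bounds.
have fC : local_contraction N (controlled_map F U Xstar) Xstar r nu.
  by move=> n X Xr; rewrite controlled_map_subl; apply: contraction.
have cvgX X : solution (controlled_map F U Xstar) X ->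
    norm_ball N Xstar r (X 0%N) -> norm_cvg N X Xstar.
  by apply: (local_contraction_cvg N_norm _ fC); rewrite ltW.
split=> //; split=> //.
- move=> n; apply/eqP.
  by rewrite -subr_eq0 controlled_map_subl F_fix subrr mulmx0.
- by apply: (local_contraction_stable N_norm r_gt0 _ fC); rewrite !ltW.
Qed.
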